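(* Let $(M,g)$ be any oriented Riemannian surface (Riemann surface with compatible metric $g$), let $T_M\setminus M$ denote the complement of the zero-section in $T_M$, and let $f,h$ (real-valued) and $a$ (complex-valued) be smooth functions on $T_M\setminus M$ such that $f>0$ and $fh-|a|^2=\frac{1}{r^4}$, where $r^2(u)=g(u,u)$. Then the ciconia metric $\mathrm{g}_{f,a,h}$ on the open manifold $T_M\setminus M$ is Ricci-flat, i.e. its Ricci form $\rho$ vanishes.
   Context: Let $\pi:T_M\to M$ be the total space of the tangent bundle. $M$ carries the complex structure given by $g$ and the orientation. In a local holomorphic (isothermal) coordinate $z=x+iy$ on an open $\mathcal U\subset M$ write $g=\lambda\,dz\,d\bar z=\frac{\lambda}{2}(dz\otimes d\bar z+d\bar z\otimes dz)$ with $\lambda>0$ smooth, and $\Gamma=\frac1\lambda\frac{\partial\lambda}{\partial z}$. Identifying $T_zM$ with $T^{1,0}_zM=\mathbb{C}\partial_z$ via $\partial_x\mapsto\partial_z$, $\partial_y\mapsto i\partial_z$, one gets coordinates $(z,w)$ on $\pi^{-1}(\mathcal U)\cong\mathcal U\times\mathbb{C}$ ($w$ corresponds to $w\partial_z$); these are holomorphic charts making $T_M$ a complex surface. Put $\eta=dw+w\Gamma\,dz$; then $r^2=\lambda|w|^2$. The ciconia metric $\mathrm{g}_{f,a,h}$ is the real part of the globally well-defined Hermitian metric $$H=\lambda\big(f\,dz\otimes d\bar z+a\,dz\otimes\bar\eta+\bar a\,\eta\otimes d\bar z+h\,\eta\otimes\bar\eta\big),$$ positive definite when $f>0$ and $fh-|a|^2>0$.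 Its Ricci form is the closed $(1,1)$-form $\rho=i\bar\partial\partial\log\det H$, where $\det H$ is the determinant of the matrix of $H$ in the holomorphic frame $\partial_z,\partial_w$. The metric is called Ricci-flat if $\rho=0$. *)

(* Defs.v *)
From mathcomp Require Import all_boot all_order all_algebra.
From mathcomp Require Import complex.
From mathcomp Require Import all_classical all_reals all_analysis.

Set Implicit Arguments.
Unset Strict Implicit.
Unset Printing Implicit Defensive.

Import Order.TTheory GRing.Theory Num.Theory numFieldNormedType.Exports.

Local Open Scope classical_set_scope.
Local Open Scope ring_scope.
Local Open Scope complex_scope.

Section Smooth.
Context {R : realType}.

(* Intended for [U] open and [V] finite-dimensional, where controlling all
   directional derivatives amounts to controlling all partial derivatives. *)
Fixpoint Ck {V W : normedModType R} (k : nat) (U : set V) (F : V -> W) : Prop :=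
  if k is k'.+1 then
    {in U, forall x, differentiable F x} /\
    forall v, Ck k' U (fun x => 'D_v F x)
  else {in U, continuous F}.

Definition smooth_on {V W : normedModType R} (U : set V) (F : V -> W) : Prop :=
  forall k, Ck k U F.

Definition jacobian_det (F : R * R -> R * R) (x : R * R) : R :=
  let Fx : R * R := 'D_((1, 0) : R * R) F x in
  let Fy : R * R := 'D_((0, 1) : R * R) F x in
  Fx.1 * Fy.2 - Fy.1 * Fx.2.

Lemma diff_near_comp {U V W : normedModType R} (f : U -> V) (g : V -> W)
    (k : U -> W) (x v : U) :
  differentiable f x -> differentiable g (f x) -> differentiable k x ->
  (\forall y \near x, k y = g (f y)) ->
  'd k x v = 'd g (f x) ('d f x v).
Proof.
move=> df dg dk kgf; have dgf := differentiable_comp df dg.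
have /(congr1 (fun L : U -> W => L v)) H := diff_comp df dg.
apply: etrans H; rewrite -(deriveE v dk) -(deriveE v dgf).
exact: near_eq_derive.
Qed.

Lemma diff_near_id {V : normedModType R} (f : V -> V) (x v : V) :
  differentiable f x -> (\forall y \near x, f y = y) -> 'd f x v = v.
Proof.
move=> df fid; rewrite -deriveE //.
by rewrite (near_eq_derive _ (g := id)) // derive_id.
Qed.

End Smooth.

(* Outside [cdom] and [ccodom] the two maps carry no information. *)
Record chart (R : realType) (M : topologicalType) := Chart {
  cdom : set M;
  ccodom : set (R * R);
  cmap : M -> R * R;
  cinv : R * R -> M;
  cdom_open : open cdom;
  ccodom_open : open ccodom;
  cmap_ccodom : {homo cmap : p / cdom p >-> ccodom p};
  cinv_cdom : {homo cinv : x / ccodom x >-> cdom x};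
  cmapK : forall p, cdom p -> cinv (cmap p) = p;
  cinvK : forall x, ccodom x -> cmap (cinv x) = x;
  cmap_continuous : {in cdom, continuous cmap};
  cinv_continuous : {in ccodom, continuous cinv} }.

Definition overlap (R : realType) (M : topologicalType) (c c' : chart R M)
    : set (R * R) :=
  ccodom c `&` cinv c @^-1` cdom c'.

Definition transition (R : realType) (M : topologicalType) (c c' : chart R M)
    : R * R -> R * R :=
  cmap c' \o cinv c.

Definition oriented_compat (R : realType) (M : topologicalType)
    (c c' : chart R M) : Prop :=
  smooth_on (overlap c c') (transition c c') /\
  {in overlap c c', forall x, 0 < jacobian_det (transition c c') x}.

Record orientedSurface (R : realType) := OrientedSurface {
  carrier :> topologicalType;
  surface_hausdorff : hausdorff_space carrier;
  surface_second_countable : @second_countable carrier;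
  atlas : set (chart R carrier);
  atlas_cover : forall p, exists2 c, atlas c & cdom c p;
  atlas_compat : forall c c', atlas c -> atlas c' -> oriented_compat c c';
  atlas_maximal : forall c,
    (forall c', atlas c' -> oriented_compat c c' /\ oriented_compat c' c) ->
    atlas c }.

Section Tangent.
Context {R : realType} {M : orientedSurface R}.

Definition chart_at (p : M) (c : chart R M) : Prop := atlas c /\ cdom c p.

(* A tangent vector at [p] is its family of coordinates in all the charts at
   [p], subject to the usual transformation rule. The value 0 at the other
   charts makes the family determined by the vector. *)
Record tangent (p : M) := Tangent {
  tcoord : chart R M -> R * R;
  tcoord_transition : forall c c', chart_at p c -> chart_at p c' ->
    tcoord c' = 'd (transition c c') (cmap c p) (tcoord c);
  tcoord_out : forall c, ~ chart_at p c -> tcoord c = 0 }.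

Definition tangentBundle : Type := {p : M & tangent p}.

Lemma overlap_open (c c' : chart R M) : open (overlap c c').
Proof.
rewrite openE => x [cx c'x]; rewrite /interior; apply: filterI.
  by apply: open_nbhs_nbhs; split => //; exact: ccodom_open.
apply: (cinv_continuous (c := c)); first by rewrite inE.
by apply: open_nbhs_nbhs; split => //; exact: cdom_open.
Qed.

Lemma overlap_cmap (p : M) (c c' : chart R M) :
  chart_at p c -> chart_at p c' -> overlap c c' (cmap c p).
Proof.
move=> [_ cp] [_ c'p]; split; first exact: cmap_ccodom.
by rewrite /= cmapK.
Qed.

Lemma transition_differentiable (p : M) (c c' : chart R M) :
  chart_at p c -> chart_at p c' ->
  differentiable (transition c c') (cmap c p).
Proof.
move=> cp c'p; have [/(_ 1%N)[+ _] _] := atlas_compat cp.1 c'p.1.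
by apply; rewrite inE; exact: overlap_cmap.
Qed.

Lemma transition_chain (p : M) (c c1 c2 : chart R M) (v : R * R) :
  chart_at p c -> chart_at p c1 -> chart_at p c2 ->
  'd (transition c c2) (cmap c p) v =
  'd (transition c1 c2) (cmap c1 p) ('d (transition c c1) (cmap c p) v)
    :> R * R.
Proof.
move=> cp c1p c2p.
have E : transition c c1 (cmap c p) = cmap c1 p.
  by rewrite /transition /= cmapK //; exact: cp.2.
rewrite -E; apply: diff_near_comp.
- exact: transition_differentiable.
- by rewrite E; exact: transition_differentiable.
- exact: transition_differentiable.
have : nbhs (cmap c p) (overlap c c1).
  apply: open_nbhs_nbhs; split; first exact: overlap_open.
  exact: overlap_cmap.
apply: filterS => x [_ c1x].
by rewrite /transition /= cmapK.
Qed.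

Section OfCoord.
Variables (c : chart R M) (p : M) (v : R * R).

Let coords (c' : chart R M) : R * R :=
  if `[< chart_at p c /\ chart_at p c' >]
  then 'd (transition c c') (cmap c p) v else 0.

Let coords_transition (c1 c2 : chart R M) : chart_at p c1 -> chart_at p c2 ->
  coords c2 = 'd (transition c1 c2) (cmap c1 p) (coords c1).
Proof.
move=> c1p c2p; rewrite /coords.
have [cp|ncp] := pselect (chart_at p c).
  rewrite !asboolT //; exact: transition_chain.
by rewrite !asboolF ?linear0 // => -[].
Qed.

Let coords_out (c' : chart R M) : ~ chart_at p c' -> coords c' = 0.
Proof. by move=> nc'p; rewrite /coords asboolF // => -[]. Qed.

(* The tangent vector at [p] with coordinates [v] in the chart [c]. *)
Definition tangent_of : tangent p := Tangent coords_transition coords_out.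

Lemma tcoord_tangent_of : chart_at p c -> tcoord tangent_of c = v.
Proof.
move=> cp; rewrite /= /coords asboolT //.
apply: diff_near_id; first exact: transition_differentiable.
have : nbhs (cmap c p) (ccodom c).
  apply: open_nbhs_nbhs; split; first exact: ccodom_open.
  exact: cmap_ccodom cp.2.
by apply: filterS => x cx; rewrite /transition /= cinvK.
Qed.

End OfCoord.

Definition off_zero_section : set tangentBundle :=
  [set u | exists c, tcoord (projT2 u) c != 0].

(* The inverse of the bundle chart u |-> (z, w) induced by [c]. *)
Definition bundle_cinv (c : chart R M) (x : (R * R) * (R * R))
    : tangentBundle :=
  existT _ (cinv c x.1) (tangent_of c (cinv c x.1) x.2).

Definition slit_codom (c : chart R M) : set ((R * R) * (R * R)) :=
  [set x | ccodom c x.1 /\ x.2 != 0].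

Definition smooth_off_zero (F : tangentBundle -> R) : Prop :=
  forall c, atlas c -> smooth_on (slit_codom c) (F \o bundle_cinv c).

End Tangent.

Arguments tangent {R} M p.
Arguments tangentBundle {R} M.
Arguments off_zero_section {R} M.

Record riemannian (R : realType) (M : orientedSurface R) := Riemannian {
  metric : forall p : M, tangent M p -> tangent M p -> R;
  (* g = E dx^2 + 2 F dx dy + G dy^2 *)
  metric_local : forall c, atlas c -> exists E F G : R * R -> R,
    [/\ smooth_on (ccodom c) E, smooth_on (ccodom c) F, smooth_on (ccodom c) G &
        forall p (u v : tangent M p), cdom c p ->
          let x := tcoord u c in let y := tcoord v c in let z := cmap c p in
          metric u v = E z * (x.1 * y.1) + F z * (x.1 * y.2 + x.2 * y.1)
                       + G z * (x.2 * y.2)];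
  metric_pos : forall p (u : tangent M p),
    (exists c, tcoord u c != 0) -> 0 < metric u u }.

Arguments metric {R M} _ {p} u v.

Section Holomorphic.
Context {R : realType}.

Definition to_complex (z : R * R) : R[i] := z.1 +i* z.2.

Definition Dcomplex {V : normedModType R} (v : V) (F : V -> R[i]) (x : V)
    : R[i] :=
  'D_v (fun y => complex.Re (F y)) x +i* 'D_v (fun y => complex.Im (F y)) x.

(* The derivatives d/dz and d/dzbar, where [ex] and [ey] are the directions of
   the real and imaginary parts of z. *)
Definition wirtinger {V : normedModType R} (ex ey : V) (F : V -> R[i]) (x : V)
    : R[i] :=
  (Dcomplex ex F x - 'i%C * Dcomplex ey F x) / 2%:R.

Definition wirtinger_bar {V : normedModType R} (ex ey : V) (F : V -> R[i])
    (x : V) : R[i] :=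
  (Dcomplex ex F x + 'i%C * Dcomplex ey F x) / 2%:R.

(* C^2 is (R * R) * (R * R), with coordinates z (index 0) and w (index 1). *)
Definition dir_re (j : 'I_2) : (R * R) * (R * R) :=
  if j == ord0 then ((1, 0), (0, 0)) else ((0, 0), (1, 0)).
Definition dir_im (j : 'I_2) : (R * R) * (R * R) :=
  if j == ord0 then ((0, 1), (0, 0)) else ((0, 0), (0, 1)).

Definition hol_partial (j : 'I_2) (F : (R * R) * (R * R) -> R[i])
    : (R * R) * (R * R) -> R[i] :=
  wirtinger (dir_re j) (dir_im j) F.

Definition antihol_partial (j : 'I_2) (F : (R * R) * (R * R) -> R[i])
    : (R * R) * (R * R) -> R[i] :=
  wirtinger_bar (dir_re j) (dir_im j) F.

(* A field of sesquilinear forms on an open subset of C^2; the row vector X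
   stands for X_0 d/dz + X_1 d/dw. *)
Definition form_field : Type :=
  (R * R) * (R * R) -> 'rV[R[i]]_2 -> 'rV[R[i]]_2 -> R[i].

Definition frame_matrix (H : form_field) (x : (R * R) * (R * R))
    : 'M[R[i]]_2 :=
  \matrix_(j, k) H x (delta_mx 0 j) (delta_mx 0 k).

(* The determinant of a Hermitian matrix is real. *)
Definition log_det (H : form_field) (x : (R * R) * (R * R)) : R[i] :=
  (ln (complex.Re (\det (frame_matrix H x))))%:C.

(* i dbar d u = i sum_(j, k) (d_kbar d_j u) dzbar_k /\ dz_j. *)
Definition ricci_form (H : form_field) (x : (R * R) * (R * R))
    (X Y : 'rV[R[i]]_2) : R[i] :=
  'i%C * \sum_(j < 2) \sum_(k < 2)
    antihol_partial k (hol_partial j (log_det H)) x *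
    (conjc (X ord0 k) * Y ord0 j - conjc (Y ord0 k) * X ord0 j).

End Holomorphic.

Section Ciconia.
Context {R : realType} {M : orientedSurface R} (g : riemannian M).

Definition r2 (u : tangentBundle M) : R := metric g (projT2 u) (projT2 u).

Definition conformal_factor (c : chart R M) (z : R * R) : R :=
  r2 (bundle_cinv c (z, (1, 0))).

(* A holomorphic coordinate for the complex structure defined by [g] and the
   orientation is a positively oriented isothermal chart; as
   g = lambda dz dzbar = lambda (dx^2 + dy^2), lambda is g(d/dx, d/dx). *)
Definition holomorphic_chart (c : chart R M) : Prop :=
  atlas c /\
  forall p (u v : tangent M p), cdom c p ->
    metric g u v = conformal_factor c (cmap c p) *
      ((tcoord u c).1 * (tcoord v c).1 + (tcoord u c).2 * (tcoord v c).2).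

Definition Gamma (c : chart R M) (z : R * R) : R[i] :=
  wirtinger ((1, 0) : R * R) (0, 1) (fun y => (conformal_factor c y)%:C) z
  / (conformal_factor c z)%:C.

Definition dz (X : 'rV[R[i]]_2) : R[i] := X ord0 ord0.
Definition dw (X : 'rV[R[i]]_2) : R[i] := X ord0 ord_max.

Definition eta (c : chart R M) (x : (R * R) * (R * R)) (X : 'rV[R[i]]_2)
    : R[i] :=
  dw X + to_complex x.2 * Gamma c x.1 * dz X.

(* The ciconia Hermitian metric, whose real part is g_{f,a,h}, in the bundle
   coordinates (z, w) given by [c]. *)
Definition ciconia_hermitian (f : tangentBundle M -> R)
    (a : tangentBundle M -> R[i]) (h : tangentBundle M -> R) (c : chart R M)
    : form_field :=
  fun x X Y =>
    let u := bundle_cinv c x in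
    let eta := eta c x in
    (conformal_factor c x.1)%:C *
    ((f u)%:C * dz X * conjc (dz Y) + a u * dz X * conjc (eta Y)
     + conjc (a u) * eta X * conjc (dz Y) + (h u)%:C * eta X * conjc (eta Y)).

(* For a Hermitian metric on the complement of the zero section, given by its
   expressions in the holomorphic bundle charts. *)
Definition ricci_flat (H : chart R M -> form_field) : Prop :=
  forall c, holomorphic_chart c ->
    forall x, slit_codom c x -> forall X Y, ricci_form (H c) x X Y = 0.

End Ciconia.

(* Main.v *)
Require Import Defs.
From mathcomp Require Import all_boot all_order all_algebra.
From mathcomp Require Import complex.
From mathcomp Require Import all_classical all_reals all_analysis.
From mathcomp Require Import ring.

Set Implicit Arguments.
Unset Strict Implicit.
Unset Printing Implicit Defensive.

Import Order.TTheory GRing.Theory Num.Theory numFieldNormedType.Exports.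

Local Open Scope classical_set_scope.
Local Open Scope ring_scope.
Local Open Scope complex_scope.

(** The Ricci form only sees log det H. In the coframe dz, eta the matrix of H
    is lambda times [[f, a], [conj a, h]], and dz, eta differ from dz, dw by a
    unipotent triangular matrix: eta = dw + w Gamma dz. The Christoffel term
    therefore cancels from the determinant ([det_ciconia]), which equals
    lambda^2 (f h - |a|^2) = lambda^2 / r^4. In a holomorphic (isothermal) chart
    r^2 = lambda |w|^2 ([r2_bundle_cinv]), so lambda cancels as well and
    det H = |w|^-4 ([log_det_ciconia]): whatever f, a, h and g are, the
    potential is the explicit function -2 log |w|^2.

    That function is pluriharmonic off w = 0. Its derivative in z vanishes and
    its derivative in w is -2 / w ([hol_partial_log_fibre]), which is
    holomorphic ([antihol_partial_dlog_fibre]), so every mixed second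
    derivative vanishes. The two functions agree only where w != 0, but this is
    an open condition and derivatives are local, so the computation for
    |w|^2 transfers to log det H. *)

(** * Directional derivatives and Wirtinger derivatives *)

Lemma is_derive_affine_along (R : realType) (V : normedModType R) (f : V -> R)
    (x v : V) (d : R) :
  (forall t, f (t *: v + x) = t * d + f x) -> is_derive x v f d.
Proof.
move=> fE.
have cvd : (fun t => t^-1 *: ((f \o shift x) (t *: v) - f x)) @ 0^' --> d.
  apply: cvg_near_cst; near=> t.
  have t0 : t != 0 by near: t; exact: nbhs_dnbhs_neq.
  by rewrite /= fE addrK; exact: mulKf.
apply: DeriveDef; first by apply/cvg_ex; exists d.
exact: cvg_lim cvd.
Unshelve. all: by end_near. Qed.

(** Restricting to the line through [x] with direction [v] reduces the claim to
    the chain rule for functions of one real variable. *)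
Lemma is_derive_comp1 (R : realType) (V : normedModType R) (f : V -> R)
    (phi : R -> R) (x v : V) (df dphi : R) :
  is_derive (f x) 1 phi dphi -> is_derive x v f df ->
  is_derive x v (phi \o f) (dphi * df).
Proof.
move=> Dphi Df.
have lineE F : 'D_v F x = 'D_1 (fun t : R => F (t *: v + x)) 0 :> R.
  rewrite /derive; set q1 := fun t => t^-1 *: _; set q2 := fun t => t^-1 *: _.
  suff -> : q1 = q2 by [].
  apply/funext => t; rewrite /q1 /q2 /=.
  by rewrite addr0 scale0r add0r [_%:A]mulr1.
have Dline : is_derive (0 : R) 1 (fun t : R => f (t *: v + x)) df.
  by apply: DeriveDef; [exact: (derivable1P f x v).1|rewrite -lineE derive_val].
have Dphi0 : is_derive (f (0 *: v + x)) 1 phi dphi by rewrite scale0r add0r.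
have D := is_derive1_comp Dphi0 Dline.
apply: DeriveDef.
  exact: (derivable1P (phi \o f) x v).2 (ex_derive (is_derive := D)).
by rewrite lineE derive_val mulrC.
Qed.

Lemma wirtinger_real (R : realType) (V : normedModType R) (ex ey : V)
    (F : V -> R) (x : V) :
  wirtinger ex ey (fun y => (F y)%:C) x =
  ('D_ex F x / 2) +i* (- ('D_ey F x / 2)).
Proof.
rewrite /wirtinger /Dcomplex /= !derive_cst.
apply: (canLR (mulfK _)); first by rewrite pnatr_eq0.
apply/eqP; rewrite eq_complex /=; simpc.
by apply/andP; split; apply/eqP; field.
Qed.

Lemma cauchy_riemann_wirtinger_bar (R : realType) (V : normedModType R)
    (ex ey : V) (F : V -> R[i]) (x : V) :
  'D_ex (fun y => complex.Re (F y)) x = 'D_ey (fun y => complex.Im (F y)) x ->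
  'D_ey (fun y => complex.Re (F y)) x = - 'D_ex (fun y => complex.Im (F y)) x ->
  wirtinger_bar ex ey F x = 0.
Proof.
move=> CR1 CR2; rewrite /wirtinger_bar /Dcomplex CR1 CR2.
by simpc.
Qed.

Lemma near_eq_Dcomplex (R : realType) (V : normedModType R) (v x : V)
    (F G : V -> R[i]) :
  (\near x, F x = G x) -> Dcomplex v F x = Dcomplex v G x.
Proof.
move=> FG; rewrite /Dcomplex.
have D (p : R[i] -> R) : 'D_v (fun y => p (F y)) x = 'D_v (fun y => p (G y)) x.
  by apply: near_eq_derive; apply: filterS FG => y ->.
by rewrite !D.
Qed.

Lemma near_eq_hol_partial (R : realType) (j : 'I_2)
    (F G : (R * R) * (R * R) -> R[i]) (x : (R * R) * (R * R)) :
  (\near x, F x = G x) -> hol_partial j F x = hol_partial j G x.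
Proof.
by move=> FG; rewrite /hol_partial /wirtinger !(near_eq_Dcomplex _ FG).
Qed.

Lemma near_eq_antihol_partial (R : realType) (j : 'I_2)
    (F G : (R * R) * (R * R) -> R[i]) (x : (R * R) * (R * R)) :
  (\near x, F x = G x) -> antihol_partial j F x = antihol_partial j G x.
Proof.
move=> FG.
by rewrite /antihol_partial /wirtinger_bar !(near_eq_Dcomplex _ FG).
Qed.

(** * Pluriharmonicity of the logarithm of the fibre norm *)

Definition fibre_norm2 (R : realType) (y : (R * R) * (R * R)) : R :=
  y.2.1 ^+ 2 + y.2.2 ^+ 2.

Lemma fibre_norm2_gt0 (R : realType) (y : (R * R) * (R * R)) :
  y.2 != 0 -> 0 < fibre_norm2 y.
Proof.
move=> y0; rewrite lt_neqAle addr_ge0 ?sqr_ge0 // andbT eq_sym.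
apply: contra y0; rewrite paddr_eq0 ?sqr_ge0 // !sqrf_eq0.
by case: y => z [u v] /= /andP[/eqP-> /eqP->].
Qed.

Lemma is_derive_fibre_re (R : realType) (y v : (R * R) * (R * R)) :
  is_derive y v (fun y => y.2.1) v.2.1.
Proof. exact: is_derive_affine_along. Qed.

Lemma is_derive_fibre_im (R : realType) (y v : (R * R) * (R * R)) :
  is_derive y v (fun y => y.2.2) v.2.2.
Proof. exact: is_derive_affine_along. Qed.

Lemma is_derive_fibre_norm2 (R : realType) (y v : (R * R) * (R * R)) :
  is_derive y v (@fibre_norm2 R) (2 * (y.2.1 * v.2.1 + y.2.2 * v.2.2)).
Proof.
have Dre := is_derive_fibre_re y v; have Dim := is_derive_fibre_im y v.
have D := is_deriveD (is_deriveX 2 Dre) (is_deriveX 2 Dim).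
apply: is_derive_eq D _; rewrite /GRing.scale /=; ring.
Qed.

Lemma is_derive_log_fibre_norm2 (R : realType) (y v : (R * R) * (R * R)) :
  y.2 != 0 ->
  is_derive y v (fun y => - 2 * ln (fibre_norm2 y))
    (- 4 * (y.2.1 * v.2.1 + y.2.2 * v.2.2) / fibre_norm2 y).
Proof.
move=> y0; have N0 := fibre_norm2_gt0 y0.
have Dln := is_deriveZ (- 2) (is_derive1_ln N0).
apply: is_derive_eq (is_derive_comp1 Dln
  (is_derive_fibre_norm2 y v)) _.
by rewrite /GRing.scale /=; field; rewrite gt_eqF.
Qed.

Lemma is_derive_fibre_quotient (R : realType) (y v : (R * R) * (R * R))
    (c dl : R) (l : (R * R) * (R * R) -> R) :
  y.2 != 0 -> is_derive y v l dl ->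
  is_derive y v (fun y => c * (l y / fibre_norm2 y))
    (c * (dl / fibre_norm2 y
       - l y * (2 * (y.2.1 * v.2.1 + y.2.2 * v.2.2)) / fibre_norm2 y ^+ 2)).
Proof.
move=> y0 Dl; have N0 : fibre_norm2 y != 0 by rewrite gt_eqF ?fibre_norm2_gt0.
have Dinv := is_deriveV (f := id) N0 (is_derive_id (fibre_norm2 y) (1 : R)).
have D := is_deriveZ c (is_deriveM Dl (is_derive_comp1 Dinv
  (is_derive_fibre_norm2 y v))).
by apply: is_derive_eq D _; rewrite /GRing.scale /=; field.
Qed.

(** The (1,0)-derivatives of -2 log |w|^2: zero in z, and -2 / w in w, written
    as -2 conj(w) / |w|^2 to have its real and imaginary parts at hand. *)
Definition dlog_fibre (R : realType) (j : 'I_2) (y : (R * R) * (R * R))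
    : R[i] :=
  if j == ord0 then 0 else
  (- 2 * (y.2.1 / fibre_norm2 y)) +i* (2 * (y.2.2 / fibre_norm2 y)).

Lemma hol_partial_log_fibre (R : realType) (j : 'I_2) (y : (R * R) * (R * R)) :
  y.2 != 0 ->
  hol_partial j (fun y => (- 2 * ln (fibre_norm2 y))%:C) y
  = dlog_fibre j y.
Proof.
move=> y0.
have D v := derive_val (is_derive := is_derive_log_fibre_norm2 v y0).
have N0 : fibre_norm2 y != 0 by rewrite gt_eqF ?fibre_norm2_gt0.
rewrite /hol_partial wirtinger_real !D /dlog_fibre /dir_re /dir_im.
by case: (j == ord0) => /=; apply/eqP; rewrite eq_complex /=;
  apply/andP; split; apply/eqP; field.
Qed.

(** Both 0 and -2 / w satisfy the Cauchy-Riemann equations in each variable. *)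
Lemma antihol_partial_dlog_fibre (R : realType) (j k : 'I_2)
    (y : (R * R) * (R * R)) :
  y.2 != 0 -> antihol_partial k (dlog_fibre j) y = 0.
Proof.
move=> y0; have N0 : fibre_norm2 y != 0 by rewrite gt_eqF ?fibre_norm2_gt0.
have DP v := derive_val (is_derive :=
  is_derive_fibre_quotient (- 2) y0 (is_derive_fibre_re y v)).
have DQ v := derive_val (is_derive :=
  is_derive_fibre_quotient 2 y0 (is_derive_fibre_im y v)).
rewrite /dlog_fibre; apply: cauchy_riemann_wirtinger_bar;
  case: (j == ord0) => /=; rewrite ?derive_cst ?oppr0 //= DP DQ
  /dir_re /dir_im;
  case: (k == ord0) => /=; rewrite /fibre_norm2; field; exact: N0.
Qed.

(** * The determinant of the ciconia metric *)

Lemma slit_codom_open (R : realType) (M : orientedSurface R) (c : chart R M) :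
  open (slit_codom c).
Proof.
have -> : slit_codom c = fst @^-1` ccodom c `&` snd @^-1` (~` [set 0]).
  by apply/seteqP; split => y [cy /eqP y0].
apply: openI; apply: open_comp.
- by move=> y _; exact: cvg_fst.
- exact: ccodom_open.
- by move=> y _; exact: cvg_snd.
- apply: closed_openC; apply: accessible_closed_set1.
  exact/hausdorff_accessible/norm_hausdorff.
Qed.

Lemma det_mx22 (K : comNzRingType) (A : 'M[K]_2) :
  \det A = A 0 0 * A 1 1 - A 0 1 * A 1 0.
Proof.
rewrite (expand_det_row _ ord0) !big_ord_recl big_ord0 addr0 /cofactor.
rewrite !det_mx11 !mxE /= expr0 expr1 mul1r mulN1r mulrN.
by congr (A _ _ * A _ _ - A _ _ * A _ _); apply/val_inj.
Qed.

(** With G = w Gamma, the matrix in the frame d/dz, d/dw is the congruence of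
    lambda [[f, a], [conj a, h]] by [[1, G], [0, 1]], so G drops out. *)
Lemma det_ciconia (R : realType) (M : orientedSurface R) (g : riemannian M)
    (f h : tangentBundle M -> R) (a : tangentBundle M -> R[i]) (c : chart R M)
    (x : (R * R) * (R * R)) :
  let u := bundle_cinv c x in
  \det (frame_matrix (ciconia_hermitian g f a h c) x) =
  (conformal_factor g c x.1)%:C ^+ 2
    * ((f u)%:C * (h u)%:C - a u * conjc (a u)).
Proof.
move=> u; rewrite det_mx22.
have frameE H i j :
    frame_matrix H x i j = H x (delta_mx 0 i) (delta_mx 0 j) :> R[i].
  by rewrite mxE.
have dzE i : dz (delta_mx 0 i : 'rV[R[i]]_2) = (i == 0)%:R.
  by rewrite /dz mxE eqxx eq_sym.
have dwE i : dw (delta_mx 0 i : 'rV[R[i]]_2) = (i == 1)%:R.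
  by rewrite /dw mxE eqxx eq_sym; congr (_ == _)%:R; apply/val_inj.
rewrite !frameE /ciconia_hermitian /eta -/u !dzE !dwE.
move: (to_complex _ * _) (_)%:C (f u)%:C (h u)%:C (a u) => G l F H b.
have e01 : (0 == 1 :> 'I_2) = false by [].
by rewrite !eqxx e01 eq_sym e01 !rmorphD !rmorphM !rmorph0 !rmorph1; ring.
Qed.

Lemma mulc_conj_normc (R : realType) (z : R[i]) :
  z * conjc z = (ComplexField.Normc.normc z ^+ 2)%:C.
Proof.
case: z => p q; rewrite /= sqr_sqrtr ?addr_ge0 ?sqr_ge0 //.
by simpc; congr (_ +i* _); ring.
Qed.

(** This is where isothermal coordinates are used: r^2 = lambda |w|^2. *)
Lemma r2_bundle_cinv (R : realType) (M : orientedSurface R) (g : riemannian M)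
    (c : chart R M) (x : (R * R) * (R * R)) :
  holomorphic_chart g c -> ccodom c x.1 ->
  r2 g (bundle_cinv c x) = conformal_factor g c x.1 * fibre_norm2 x.
Proof.
move=> [ac iso] cx; have cp := cinv_cdom cx.
by rewrite /r2 iso // cinvK // tcoord_tangent_of // -!expr2.
Qed.

Lemma bundle_cinv_off_zero (R : realType) (M : orientedSurface R)
    (c : chart R M) (x : (R * R) * (R * R)) :
  atlas c -> slit_codom c x -> off_zero_section M (bundle_cinv c x).
Proof.
move=> ac [cx x0]; exists c; rewrite tcoord_tangent_of //; split => //.
exact: cinv_cdom.
Qed.

(** lambda is the squared length of d/dx, which is a nonzero vector. *)
Lemma conformal_factor_gt0 (R : realType) (M : orientedSurface R)
    (g : riemannian M) (c : chart R M) (z : R * R) :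
  atlas c -> ccodom c z -> 0 < conformal_factor g c z.
Proof.
move=> ac cz; apply: metric_pos.
apply: (@bundle_cinv_off_zero R M c (z, (1, 0)) ac); split => //=.
by apply/eqP => -[/eqP]; rewrite oner_eq0.
Qed.

Lemma log_det_ciconia (R : realType) (M : orientedSurface R) (g : riemannian M)
    (f h : tangentBundle M -> R) (a : tangentBundle M -> R[i]) (c : chart R M)
    (x : (R * R) * (R * R)) :
  (forall u, off_zero_section M u ->
     f u * h u - ComplexField.Normc.normc (a u) ^+ 2 = 1 / r2 g u ^+ 2) ->
  holomorphic_chart g c -> slit_codom c x ->
  log_det (ciconia_hermitian g f a h c) x = (- 2 * ln (fibre_norm2 x))%:C.
Proof.
move=> detE hc sx; have [cx x0] := sx; congr (_%:C).
have l0 := conformal_factor_gt0 g hc.1 cx.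
have N0 := fibre_norm2_gt0 x0.
rewrite det_ciconia mulc_conj_normc -!rmorphM -rmorphB -rmorphXn -rmorphM /=.
rewrite detE; last exact: bundle_cinv_off_zero hc.1 sx.
rewrite r2_bundle_cinv // exprMn.
have -> : conformal_factor g c x.1 ^+ 2
    * (1 / (conformal_factor g c x.1 ^+ 2 * fibre_norm2 x ^+ 2))
  = (fibre_norm2 x ^+ 2)^-1 by field; rewrite !gt_eqF.
by rewrite lnV ?posrE ?exprn_gt0 // lnXn // mulNr mulr_natl.
Qed.

Unset Implicit Arguments.

Theorem theorem2p3 (R : realType) (M : orientedSurface R) (g : riemannian M)
    (f h : tangentBundle M -> R) (a : tangentBundle M -> R[i]) :
  smooth_off_zero f -> smooth_off_zero h ->
  smooth_off_zero (fun u => complex.Re (a u)) ->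
  smooth_off_zero (fun u => complex.Im (a u)) ->
  (forall u, off_zero_section M u -> 0 < f u) ->
  (forall u, off_zero_section M u ->
     f u * h u - ComplexField.Normc.normc (a u) ^+ 2 = 1 / r2 g u ^+ 2) ->
  ricci_flat g (ciconia_hermitian g f a h).
Proof.
move=> _ _ _ _ _ detE c hc x sx X Y; rewrite /ricci_form.
have near_slit y : slit_codom c y -> \forall z \near y, slit_codom c z.
  by move=> sy; apply: open_nbhs_nbhs; split => //; exact: slit_codom_open.
rewrite big1 ?mulr0 // => j _; rewrite big1 // => k _.
(* The potential and its first derivatives are replaced near [x] only: an
   equality at the point would not survive differentiation. *)
suff -> : antihol_partial k (hol_partial j
    (log_det (ciconia_hermitian g f a h c))) x = 0 by rewrite mul0r.
rewrite -(antihol_partial_dlog_fibre j k sx.2).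
apply: near_eq_antihol_partial; apply: filterS (near_slit x sx) => y sy.
rewrite -hol_partial_log_fibre; last exact: sy.2.
apply: near_eq_hol_partial; apply: filterS (near_slit y sy) => z sz.
exact: log_det_ciconia.
Qed.
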